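(* Let $R$ be a (commutative) principal ideal domain, presented as a quotient $R=\mathbb Z\langle\mathbf v\rangle/I$ of a free associative ring on an alphabet $\mathbf v$ by a two-sided ideal, let $\mathsf R$ be a multivariate Ore extension of $R$, and let $m=1$, i.e. $F=\{g_1,\dots,g_u\}\subset\mathsf R\setminus\{0\}$, $\mathbf M(g_i)=c_i\tau_i$. Assume that $\mathbb I_W(F)$ is an ideal of $\mathsf R$ and that for each $g_j\in F$ all the elements $Y_i\star g_j$ ($1\le i\le n$) and $g_j\star\alpha_\upsilon(v)$ ($v\in\mathbf v$, $\upsilon\in\mathcal T$, $\upsilon<\mathbf T(g_j)$) have a restricted representation in terms of $F$. Then for $1\le i<j\le u$: $$\mathbf M(i)\diamond\mathbf M(j)=\mathbf M(i,j)\iff\mathrm{lcm}(\tau_i,\tau_j)=\tau_i\tau_j\ \text{and}\ \mathrm{lcm}(c_i,c_j)=c_ic_j,$$ and if these equivalent conditions hold, then $0$ is a restricted (weak) normal form of $B_W(i,j)$ with respect to $F$, i.e. $\mathrm{NF}_W(B_W(i,j),F)=0$.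
   Context: **Ore extensions.** A multivariate Ore extension $\mathsf R=R[Y_1;\alpha_1,\delta_1]\cdots[Y_n;\alpha_n,\delta_n]$ of a domain $R$ is an iterated Ore extension ($Y_i\star r=\alpha_i(r)Y_i+\delta_i(r)$, $\alpha_i$ an injective ring endomorphism mapping $R$ to $R$, $\delta_i$ an $\alpha_i$-derivation mapping $R$ to $R$) such that $\alpha_j\delta_i=\delta_i\alpha_j$ for $i\ne j$, $\alpha_i\alpha_j=\alpha_j\alpha_i$, $\delta_i\delta_j=\delta_j\delta_i$, and $\alpha_j(Y_i)=Y_i$, $\delta_j(Y_i)=0$ for $i<j$. Its multiplication is $\star$. It is a free left $R$-module on the set of terms $\mathcal T=\{Y_1^{a_1}\cdots Y_n^{a_n}\}$, a commutative monoid. For $\tau=Y_1^{a_1}\cdots Y_n^{a_n}$, $\alpha_\tau=\alpha_1^{a_1}\cdots\alpha_n^{a_n}:R\to R$. Fix a term ordering $<$ on $\mathcal T$ (multiplicative well-ordering) such that $\{\omega\in\mathcal T:\omega<\tau\}$ is finite for every $\tau$. $\mathbf T(f)$, $\mathrm{lc}(f)$, $\mathbf M(f)=\mathrm{lc}(f)\mathbf T(f)$: maximal term, leading coefficient, maximal monomial. **Restricted notions.** $\mathbb I_W(F)$ is the left $R$-span of $\{g\star\rho:g\in F,\rho\in\mathcal T\}$. A restricted (weak Gröbner) representation of $f$ in terms of $F$ is $f=\sum_ia_i\,g_{\ell_i}\star\rho_i$ with $a_i\in R\setminus\{0\}$, $\rho_i\in\mathcal T$, $g_{\ell_i}\in F$,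 $\mathbf T(g_{\ell_i})\rho_i\le\mathbf T(f)$ for all $i$ (zero has the empty representation). $h$ is a restricted (weak) normal form of $f$ w.r.t. $F$ if $f-h$ has a restricted weak Gröbner representation in terms of $F$ and, if $h\ne0$, $\mathbf M(h)$ is not a sum of monomials $a\,\mathrm{lc}(g)\,\mathbf T(g)\rho$ with $a\in R\setminus\{0\}$, $g\in F$, $\rho\in\mathcal T$, $\mathbf T(g)\rho=\mathbf T(h)$. **The product $\diamond$ and S-polynomials.** $\diamond:\mathsf R\times\mathsf R\to\mathsf R$ is the biadditive commutative product with $c\tau\diamond c'\tau'=cc'\tau\tau'$ for monomials, so that $c\tau\diamond g=c\,g\star\tau$. Put $\mathbf M(i)=c_i\tau_i$, $\mathbf M(i,j)=\mathrm{lcm}(c_i,c_j)\,\mathrm{lcm}(\tau_i,\tau_j)$ (lcm's in $R$ being determined up to units, equalities involving them are understood up to a unit), and $$B_W(i,j)=\frac{\mathrm{lcm}(c_i,c_j)}{c_j}\,g_j\star\frac{\mathrm{lcm}(\tau_i,\tau_j)}{\tau_j}-\frac{\mathrm{lcm}(c_i,c_j)}{c_i}\,g_i\star\frac{\mathrm{lcm}(\tau_i,\tau_j)}{\tau_i}.$$ *)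

(* Defs.v *)
From HB Require Import structures.
From mathcomp Require Import all_boot all_order all_algebra.
From mathcomp.multinomials Require Import ssrcomplements mpoly.
From mathcomp.multinomials Require monalg.

Set Implicit Arguments.
Unset Strict Implicit.
Unset Printing Implicit Defensive.

Import GRing.Theory.
Local Open Scope ring_scope.

Definition principal_ideals (R : idomainType) : Prop :=
  forall I : R -> Prop,
    I 0 -> (forall a b, I a -> I b -> I (a + b)) ->
    (forall c a, I a -> I (c * a)) ->
    exists d, forall a, I a <-> exists c, a = c * d.

Definition rdvd (R : idomainType) (a b : R) : Prop := exists c, b = c * a.

Definition is_lcm (R : idomainType) (a b l : R) : Prop :=
  [/\ rdvd a l, rdvd b l & forall x, rdvd a x -> rdvd b x -> rdvd l x].

Lemma is_lcm_exists (R : idomainType) :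
  principal_ideals R -> forall a b : R, exists l, is_lcm a b l.
Proof.
move=> pidR a b.
have [||c x [[x1 e1] [x2 e2]]|l lP] := pidR (fun x => rdvd a x /\ rdvd b x).
- by split; exists 0; rewrite mul0r.
- move=> x y [[x1 e1] [x2 e2]] [[y1 e3] [y2 e4]].
  split; first by exists (x1 + y1); rewrite e1 e3 mulrDl.
  by exists (x2 + y2); rewrite e2 e4 mulrDl.
- split; first by exists (c * x1); rewrite e1 mulrA.
  by exists (c * x2); rewrite e2 mulrA.
exists l; have /lP[al bl] : exists c, l = c * l by exists 1; rewrite mul1r.
by split=> // x ax bx; apply/lP.
Qed.

(* The import is confined to a section, as the notations of monalg clash with *)
(* those of mpoly.                                                            *)
Section FreeRing.
Import monalg.

(* The free associative ring Z<V>, as the monoid algebra over int of the free *)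
(* monoid of words on V.                                                      *)
Definition free_ring (V : choiceType) : Type := {malg int[{fmonom V}]}.
HB.instance Definition _ (V : choiceType) := GRing.Ring.on (free_ring V).

Definition free_gen (V : choiceType) (v : V) : free_ring V := << fmu v >>.

End FreeRing.

(* R = Z<V>/I, where I is the kernel of the surjection p *)
Definition presents (V : choiceType) (R : idomainType)
    (p : {rmorphism free_ring V -> R}) : Prop :=
  forall r, exists w, p w = r.

(* The conditions alpha_j(Y_i) = Y_i and delta_j(Y_i) = 0 are built into the   *)
(* extensions ore_alphax and ore_deltax below.                                *)
Record ore_data (R : idomainType) (n : nat) := OreData {
  ore_alpha : 'I_n -> {rmorphism R -> R};
  ore_delta : 'I_n -> {additive R -> R};
  ore_alpha_inj : forall i, injective (ore_alpha i);
  ore_deltaM : forall i a b,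
    ore_delta i (a * b) = ore_alpha i a * ore_delta i b + ore_delta i a * b;
  ore_alpha_delta : forall i j, i != j -> forall r,
    ore_alpha j (ore_delta i r) = ore_delta i (ore_alpha j r);
  ore_alphaC : forall i j r,
    ore_alpha i (ore_alpha j r) = ore_alpha j (ore_alpha i r);
  ore_deltaC : forall i j r,
    ore_delta i (ore_delta j r) = ore_delta j (ore_delta i r)
}.

Definition ore_alpha_term (R : idomainType) n (D : ore_data R n)
    (m : 'X_{1..n}) (r : R) : R :=
  foldr (fun i x => iter (m i) (ore_alpha D i) x) r (enum 'I_n).

(* The Ore extension is the free left R-module on the terms, so its carrier   *)
(* is {mpoly R[n]}, where 'X_[m] is the term Y^m.  The library product of     *)
(* {mpoly R[n]} is the diamond product, and the multiplication of the Ore     *)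
(* extension is ore_mul below.  ore_mulA, ore_mul1l, ore_mul1r, ore_mulDl,    *)
(* ore_mulDr, ore_mulCl, ore_mulXX, ore_mulY_ext, ore_alphax_mul and          *)
(* ore_deltax_mul show that it is the product of the iterated extension.      *)
Definition diamond (R : idomainType) n (f g : {mpoly R[n]}) : {mpoly R[n]} :=
  f * g.

(* Coefficientwise extensions of alpha_i and delta_i (they fix, resp. kill,   *)
(* every term).                                                               *)
Definition ore_alphax (R : idomainType) n (D : ore_data R n) (i : 'I_n)
    (f : {mpoly R[n]}) : {mpoly R[n]} := map_mpoly (ore_alpha D i) f.
Definition ore_deltax (R : idomainType) n (D : ore_data R n) (i : 'I_n)
    (f : {mpoly R[n]}) : {mpoly R[n]} := map_mpoly (ore_delta D i) f.

(* Left multiplication by Y_i, from                                           *)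
(*   Y_i * (c tau) = (alpha_i(c) Y_i + delta_i(c)) tau.                       *)
Definition ore_lmulY (R : idomainType) n (D : ore_data R n) (i : 'I_n)
    (f : {mpoly R[n]}) : {mpoly R[n]} :=
  ore_alphax D i f * 'X_i + ore_deltax D i f.

(* Left multiplication by Y_1^{m_1} ... Y_n^{m_n} *)
Definition ore_lmulT (R : idomainType) n (D : ore_data R n) (m : 'X_{1..n})
    (f : {mpoly R[n]}) : {mpoly R[n]} :=
  foldr (fun i h => iter (m i) (ore_lmulY D i) h) f (enum 'I_n).

Definition ore_mul (R : idomainType) n (D : ore_data R n)
    (f g : {mpoly R[n]}) : {mpoly R[n]} :=
  \sum_(m <- msupp f) f@_m *: ore_lmulT D m g.

Section OreRing.
Variables (R : idomainType) (n : nat) (D : ore_data R n).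
Implicit Types (f g h : {mpoly R[n]}) (m : 'X_{1..n}) (i j : 'I_n).

Lemma mcoeff_ore_alphax i f m : (ore_alphax D i f)@_m = ore_alpha D i f@_m.
Proof. exact: mcoeff_map_mpoly. Qed.

Lemma mcoeff_ore_deltax i f m : (ore_deltax D i f)@_m = ore_delta D i f@_m.
Proof. exact: mcoeff_map_mpoly. Qed.

Lemma ore_alphaxX i m : ore_alphax D i 'X_[m] = 'X_[m].
Proof. exact: map_mpolyX. Qed.

Lemma ore_delta1 i : ore_delta D i 1 = 0.
Proof.
have := ore_deltaM D i 1 1; rewrite !mulr1 rmorph1 mul1r => e.
by apply: (addrI (ore_delta D i 1)); rewrite addr0 -e.
Qed.

Lemma ore_deltaxX i m : ore_deltax D i 'X_[m] = 0.
Proof.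
apply/mpolyP=> k; rewrite mcoeff_ore_deltax mcoeffX mcoeff0.
by case: eqP => _; rewrite ?raddf0 ?ore_delta1.
Qed.

Fact ore_alphax_additive i : zmod_morphism (ore_alphax D i).
Proof. by move=> f g; apply/mpolyP=> m; rewrite !(mcoeff_ore_alphax, mcoeffB) raddfB. Qed.
HB.instance Definition _ i := GRing.isZmodMorphism.Build
  {mpoly R[n]} {mpoly R[n]} (ore_alphax D i) (ore_alphax_additive i).

Fact ore_deltax_additive i : zmod_morphism (ore_deltax D i).
Proof. by move=> f g; apply/mpolyP=> m; rewrite !(mcoeff_ore_deltax, mcoeffB) raddfB. Qed.
HB.instance Definition _ i := GRing.isZmodMorphism.Build
  {mpoly R[n]} {mpoly R[n]} (ore_deltax D i) (ore_deltax_additive i).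

Lemma ore_alphaxZ i c f :
  ore_alphax D i (c *: f) = ore_alpha D i c *: ore_alphax D i f.
Proof. by apply/mpolyP=> m; rewrite !(mcoeff_ore_alphax, mcoeffZ) rmorphM. Qed.

Lemma ore_deltaxZ i c f : ore_deltax D i (c *: f) =
  ore_alpha D i c *: ore_deltax D i f + ore_delta D i c *: f.
Proof.
apply/mpolyP=> m.
by rewrite mcoeffD !(mcoeff_ore_deltax, mcoeffZ) ore_deltaM.
Qed.

Lemma ore_deltaxMX i f m :
  ore_deltax D i (f * 'X_[m]) = ore_deltax D i f * 'X_[m].
Proof.
rewrite [f]mpolyE mulr_suml !raddf_sum mulr_suml; apply: eq_bigr => k _ /=.
rewrite -scalerAl -mpolyXD !ore_deltaxZ !ore_deltaxX !scaler0 !add0r.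
by rewrite mpolyXD scalerAl.
Qed.

Lemma ore_alphaxMX i f m :
  ore_alphax D i (f * 'X_[m]) = ore_alphax D i f * 'X_[m].
Proof. by rewrite /ore_alphax rmorphM /= map_mpolyX. Qed.

Fact ore_lmulY_additive i : zmod_morphism (ore_lmulY D i).
Proof.
by move=> f g; rewrite /ore_lmulY !raddfB /= mulrDl mulNr opprD addrACA.
Qed.
HB.instance Definition _ i := GRing.isZmodMorphism.Build
  {mpoly R[n]} {mpoly R[n]} (ore_lmulY D i) (ore_lmulY_additive i).

Lemma ore_lmulYZ i c f : ore_lmulY D i (c *: f) =
  ore_alpha D i c *: ore_lmulY D i f + ore_delta D i c *: f.
Proof.
by rewrite /ore_lmulY ore_alphaxZ ore_deltaxZ scalerDr -scalerAl addrA.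
Qed.

Lemma ore_lmulYMX i f m :
  ore_lmulY D i (f * 'X_[m]) = ore_lmulY D i f * 'X_[m].
Proof.
by rewrite /ore_lmulY ore_alphaxMX ore_deltaxMX mulrDl -!mulrA [_ * 'X_i]mulrC.
Qed.

Lemma ore_lmulYC i j f :
  ore_lmulY D i (ore_lmulY D j f) = ore_lmulY D j (ore_lmulY D i f).
Proof.
case: (eqVneq i j) => [->//|ij].
have aaC : ore_alphax D i (ore_alphax D j f) = ore_alphax D j (ore_alphax D i f).
  by apply/mpolyP=> m; rewrite !mcoeff_ore_alphax ore_alphaC.
have ddC : ore_deltax D i (ore_deltax D j f) = ore_deltax D j (ore_deltax D i f).
  by apply/mpolyP=> m; rewrite !mcoeff_ore_deltax ore_deltaC.
have adC a b : a != b ->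
    ore_alphax D a (ore_deltax D b f) = ore_deltax D b (ore_alphax D a f).
  move=> ab; apply/mpolyP=> m.
  rewrite !(mcoeff_ore_deltax, mcoeff_ore_alphax).
  by rewrite ore_alpha_delta // eq_sym.
rewrite /ore_lmulY !raddfD /= !ore_alphaxMX !ore_deltaxMX.
rewrite aaC ddC adC // adC 1?eq_sym // !mulrDl -!mulrA ['X_i * _]mulrC.
by rewrite !addrA; congr (_ + _); rewrite addrAC.
Qed.

Lemma iter_lmulYC i j k f :
  iter k (ore_lmulY D i) (ore_lmulY D j f) =
  ore_lmulY D j (iter k (ore_lmulY D i) f).
Proof. by elim: k => //= k ->; rewrite ore_lmulYC. Qed.

Lemma ore_lmulTS m i f :
  ore_lmulT D (m + U_(i))%MM f = ore_lmulY D i (ore_lmulT D m f).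
Proof.
rewrite /ore_lmulT.
have: uniq (enum 'I_n) by exact: enum_uniq.
have: i \in enum 'I_n by rewrite mem_enum.
elim: (enum 'I_n) => //= k s IH; rewrite inE mnmDE mnm1E.
case: (eqVneq i k) => [<- _ /andP[ins _]|ik /= ins /andP[_ us]].
  rewrite addn1 iterS; congr (ore_lmulY _ _ (iter _ _ _)).
  elim: s ins {IH} => //= a s IH; rewrite inE negb_or => /andP[ia /IH->].
  by rewrite mnmDE mnm1E (negPf ia) addn0.
by rewrite addn0 IH // iter_lmulYC.
Qed.

Lemma ore_lmulT0 f : ore_lmulT D 0%MM f = f.
Proof. by rewrite /ore_lmulT; elim: (enum _) => //= i s ->; rewrite mnm0E. Qed.

Lemma mnm_ind (P : 'X_{1..n} -> Prop) :
  P 0%MM -> (forall m i, P m -> P (m + U_(i))%MM) -> forall m, P m.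
Proof.
move=> P0 PS m; have [k] := ubnP (mdeg m); elim: k m => // k IH m lt_mk.
case: (pickP (fun i => 0 < m i)%N) => [i mi|m0]; last first.
  suff -> : m = 0%MM by [].
  by apply/mnmP=> i; rewrite mnm0E; apply/eqP; rewrite -leqn0 leqNgt m0.
have -> : m = ((m - U_(i)) + U_(i))%MM.
  rewrite submK //; apply/mnm_lepP=> j; rewrite mnm1E.
  by case: eqP => // <-.
apply: PS; apply: IH; rewrite -ltnS; apply: leq_trans lt_mk.
rewrite ltnS -[X in (_ < mdeg X)%N](@submK _ U_(i)%MM).
  by rewrite mdegD mdeg1 addn1.
by apply/mnm_lepP=> j; rewrite mnm1E; case: eqP => // <-.
Qed.

Lemma ore_lmulTD m1 m2 f :
  ore_lmulT D (m1 + m2)%MM f = ore_lmulT D m1 (ore_lmulT D m2 f).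
Proof.
elim/mnm_ind: m1 => [|m i IH]; first by rewrite add0m ore_lmulT0.
by rewrite ore_lmulTS -IH -ore_lmulTS -!addmA [(U_(i) + _)%MM]addmC.
Qed.

Fact ore_lmulT_additive m : zmod_morphism (ore_lmulT D m).
Proof.
move=> f g; elim/mnm_ind: m => [|m i IH]; first by rewrite !ore_lmulT0.
by rewrite !ore_lmulTS IH raddfB.
Qed.
HB.instance Definition _ m := GRing.isZmodMorphism.Build
  {mpoly R[n]} {mpoly R[n]} (ore_lmulT D m) (ore_lmulT_additive m).

Lemma ore_lmulTMX m f k : ore_lmulT D m (f * 'X_[k]) = ore_lmulT D m f * 'X_[k].
Proof.
elim/mnm_ind: m => [|m i IH]; first by rewrite !ore_lmulT0.
by rewrite !ore_lmulTS IH ore_lmulYMX.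
Qed.

Lemma ore_lmulTX m k : ore_lmulT D m 'X_[k] = 'X_[m + k].
Proof.
elim/mnm_ind: m => [|m i IH]; first by rewrite ore_lmulT0 add0m.
rewrite ore_lmulTS IH /ore_lmulY ore_alphaxX ore_deltaxX addr0 -mpolyXD.
by rewrite -!addmA [(k + _)%MM]addmC.
Qed.

Lemma ore_mulwE k f g : (msize f <= k)%N ->
  ore_mul D f g = \sum_(m : 'X_{1..n < k}) f@_m *: ore_lmulT D m g.
Proof.
move=> le_fk; set I : subFinType _ := 'X_{1..n < k}.
rewrite /ore_mul (big_mksub I) ?msupp_uniq //=; first last.
  by move=> x /msize_mdeg_lt /leq_trans; apply.
by rewrite big_rmcond //= => j /memN_msupp_eq0 ->; rewrite scale0r.
Qed.

Lemma ore_mulBl f g h : ore_mul D (f - g) h = ore_mul D f h - ore_mul D g h.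
Proof.
pose k := maxn (msize (f - g)) (maxn (msize f) (msize g)).
rewrite !(@ore_mulwE k) ?leq_max ?leqnn ?orbT // -sumrB.
by apply: eq_bigr => m _; rewrite mcoeffB scalerBl.
Qed.

Lemma ore_mul0l g : ore_mul D 0 g = 0.
Proof. by rewrite -[X in ore_mul D X](subrr 0) ore_mulBl subrr. Qed.

Lemma ore_mulDl f g h : ore_mul D (f + g) h = ore_mul D f h + ore_mul D g h.
Proof.
rewrite -[g in LHS]opprK ore_mulBl -[- g]add0r ore_mulBl ore_mul0l.
by rewrite add0r opprK.
Qed.

Lemma ore_mulBr f g h : ore_mul D f (g - h) = ore_mul D f g - ore_mul D f h.
Proof.
rewrite /ore_mul -sumrB; apply: eq_bigr => m _.
by rewrite raddfB /= scalerBr.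
Qed.

Lemma ore_mul0r f : ore_mul D f 0 = 0.
Proof. by rewrite /ore_mul big1 // => m _; rewrite raddf0 scaler0. Qed.

Lemma ore_mulDr f g h : ore_mul D f (g + h) = ore_mul D f g + ore_mul D f h.
Proof.
rewrite /ore_mul -big_split; apply: eq_bigr => m _.
by rewrite raddfD /= scalerDr.
Qed.

Lemma ore_mulZl c f g : ore_mul D (c *: f) g = c *: ore_mul D f g.
Proof.
pose k := maxn (msize (c *: f)) (msize f).
rewrite !(@ore_mulwE k) ?leq_max ?leqnn ?orbT // scaler_sumr.
by apply: eq_bigr => m _; rewrite mcoeffZ scalerA.
Qed.

Lemma ore_mulXl m g : ore_mul D 'X_[m] g = ore_lmulT D m g.
Proof. by rewrite /ore_mul msuppX big_seq1 mcoeffX eqxx scale1r. Qed.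

Lemma ore_mulYl i g : ore_mul D 'X_i g = ore_lmulY D i g.
Proof. by rewrite ore_mulXl -[U_(i)%MM]add0m ore_lmulTS ore_lmulT0. Qed.

Lemma ore_mulCl c g : ore_mul D c%:MP g = c *: g.
Proof. by rewrite -[c%:MP]mulr1 mul_mpolyC ore_mulZl -mpolyX0 ore_mulXl ore_lmulT0. Qed.

Lemma ore_mul1l : left_id 1 (ore_mul D).
Proof. by move=> f; rewrite -[1]/(1%:MP) ore_mulCl scale1r. Qed.

Lemma ore_mulXr f m : ore_mul D f 'X_[m] = f * 'X_[m].
Proof.
rewrite {2}[f]mpolyE mulr_suml /ore_mul; apply: eq_bigr => k _.
by rewrite ore_lmulTX mpolyXD scalerAl.
Qed.

Lemma diamondZX c m f : diamond (c *: 'X_[m]) f = c *: ore_mul D f 'X_[m].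
Proof. by rewrite ore_mulXr /diamond -scalerAl mulrC. Qed.

Lemma ore_mul1r : right_id 1 (ore_mul D).
Proof. by move=> f; rewrite -mpolyX0 ore_mulXr mpolyX0 mulr1. Qed.

Lemma ore_mulXX m k : ore_mul D 'X_[m] 'X_[k] = 'X_[m + k].
Proof. by rewrite ore_mulXl ore_lmulTX. Qed.

Lemma ore_mulYA i g h :
  ore_mul D (ore_lmulY D i g) h = ore_lmulY D i (ore_mul D g h).
Proof.
elim/mpolyind: g => [|c m g _ _ IH]; first by rewrite !raddf0 ore_mul0l raddf0.
rewrite [in RHS]ore_mulDl !raddfD /= ore_mulDl IH; congr (_ + _).
rewrite ore_lmulYZ ore_mulDl !ore_mulZl ore_lmulYZ; congr (_ *: _ + _).
rewrite /ore_lmulY ore_alphaxX ore_deltaxX addr0 -mpolyXD !ore_mulXl.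
by rewrite ore_lmulTS.
Qed.

Lemma ore_mulA : associative (ore_mul D).
Proof.
move=> f g h; elim/mpolyind: f => [|c m f _ _ IH]; first by rewrite !ore_mul0l.
rewrite !ore_mulDl IH !ore_mulZl; congr (_ *: _ + _) => {c f IH}.
rewrite !ore_mulXl; elim/mnm_ind: m => [|m i IH]; first by rewrite !ore_lmulT0.
by rewrite !ore_lmulTS IH ore_mulYA.
Qed.

Lemma ore_mulYC i c :
  ore_mul D 'X_i c%:MP = ore_alpha D i c *: 'X_i + (ore_delta D i c)%:MP.
Proof.
rewrite ore_mulYl -[c%:MP]mulr1 mul_mpolyC ore_lmulYZ /ore_lmulY -mpolyX0.
rewrite ore_alphaxX ore_deltaxX addr0 -mpolyXD add0m; congr (_ + _).
by rewrite mpolyX0 -mul_mpolyC mulr1.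
Qed.

(* On the subring of polynomials not involving Y_j (in particular on          *)
(* R[Y_1]...[Y_(j-1)]), alpha_j is a ring endomorphism, delta_j an            *)
(* alpha_j-derivation, and Y_j satisfies the Ore commutation rule.            *)
Lemma ore_mulY_ext j f :
  ore_mul D 'X_j f = ore_mul D (ore_alphax D j f) 'X_j + ore_deltax D j f.
Proof. by rewrite ore_mulYl ore_mulXr. Qed.

Lemma ore_alphax_lmulT j m g : m j = 0%N ->
  ore_alphax D j (ore_lmulT D m g) = ore_lmulT D m (ore_alphax D j g).
Proof.
elim/mnm_ind: m => [|m i IH]; first by rewrite !ore_lmulT0.
rewrite mnmDE mnm1E; case: (eqVneq i j) => [_|ij]; first by rewrite addn1.
rewrite addn0 => /IH e; rewrite !ore_lmulTS -{}e; move: (ore_lmulT _ _ _) => h.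
have e1 : ore_alphax D j (ore_alphax D i h) = ore_alphax D i (ore_alphax D j h).
  by apply/mpolyP=> k; rewrite !mcoeff_ore_alphax ore_alphaC.
have e2 : ore_alphax D j (ore_deltax D i h) = ore_deltax D i (ore_alphax D j h).
  apply/mpolyP=> k; rewrite !(mcoeff_ore_alphax, mcoeff_ore_deltax).
  by rewrite ore_alpha_delta.
by rewrite /ore_lmulY [LHS]raddfD /= ore_alphaxMX e1 e2.
Qed.

Lemma ore_deltax_lmulT j m g : m j = 0%N ->
  ore_deltax D j (ore_lmulT D m g) = ore_lmulT D m (ore_deltax D j g).
Proof.
elim/mnm_ind: m => [|m i IH]; first by rewrite !ore_lmulT0.
rewrite mnmDE mnm1E; case: (eqVneq i j) => [_|ij]; first by rewrite addn1.
rewrite addn0 => /IH e; rewrite !ore_lmulTS -{}e; move: (ore_lmulT _ _ _) => h.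
have e1 : ore_deltax D j (ore_alphax D i h) = ore_alphax D i (ore_deltax D j h).
  apply/mpolyP=> k; rewrite !(mcoeff_ore_alphax, mcoeff_ore_deltax).
  by rewrite ore_alpha_delta // eq_sym.
have e2 : ore_deltax D j (ore_deltax D i h) = ore_deltax D i (ore_deltax D j h).
  by apply/mpolyP=> k; rewrite !mcoeff_ore_deltax ore_deltaC.
by rewrite /ore_lmulY [LHS]raddfD /= ore_deltaxMX e1 e2.
Qed.

Lemma ore_alphax_mul j f g : (forall m, m \in msupp f -> m j = 0%N) ->
  ore_alphax D j (ore_mul D f g) =
  ore_mul D (ore_alphax D j f) (ore_alphax D j g).
Proof.
move=> fj; rewrite [in RHS](mpolyE f) /ore_mul raddf_sum.
rewrite [ore_alphax D j (\sum_(_ <- _) _)]raddf_sum -/(ore_mul D _ _).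
have -> (s : seq 'X_{1..n}) (F : 'X_{1..n} -> {mpoly R[n]}) h :
    ore_mul D (\sum_(m <- s) F m) h = \sum_(m <- s) ore_mul D (F m) h.
  by elim: s => [|a s IH]; rewrite ?(big_nil, big_cons) ?ore_mul0l // ore_mulDl IH.
apply: eq_big_seq => m /fj mj /=.
by rewrite !ore_alphaxZ ore_alphaxX ore_mulZl ore_mulXl ore_alphax_lmulT.
Qed.

Lemma ore_deltax_mul j f g : (forall m, m \in msupp f -> m j = 0%N) ->
  ore_deltax D j (ore_mul D f g) =
  ore_mul D (ore_alphax D j f) (ore_deltax D j g) +
  ore_mul D (ore_deltax D j f) g.
Proof.
move=> fj; rewrite [in RHS](mpolyE f) /ore_mul raddf_sum.
rewrite ![_ D j (\sum_(_ <- _) _)]raddf_sum -!/(ore_mul D _ _).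
have sE (s : seq 'X_{1..n}) (F : 'X_{1..n} -> {mpoly R[n]}) h :
    ore_mul D (\sum_(m <- s) F m) h = \sum_(m <- s) ore_mul D (F m) h.
  by elim: s => [|a s IH]; rewrite ?(big_nil, big_cons) ?ore_mul0l // ore_mulDl IH.
rewrite !sE -big_split; apply: eq_big_seq => m /fj mj /=.
rewrite ore_alphaxZ !ore_deltaxZ ore_alphaxX ore_deltaxX scaler0 add0r.
by rewrite !ore_mulZl !ore_mulXl ore_deltax_lmulT.
Qed.

End OreRing.

Definition ore_ideal (R : idomainType) n (D : ore_data R n)
    (I : {mpoly R[n]} -> Prop) : Prop :=
  [/\ I 0, forall f g, I f -> I g -> I (f + g)
    & forall f h, I f -> I (ore_mul D h f) /\ I (ore_mul D f h)].

Record term_ordering (n : nat) := TermOrdering {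
  tle :> rel 'X_{1..n};
  tle_anti : antisymmetric tle;
  tle_trans : transitive tle;
  tle_total : total tle;
  tle_mul : forall m1 m2 m, tle m1 m2 -> tle (m1 + m)%MM (m2 + m)%MM;
  tlt_wf : well_founded (fun m1 m2 : 'X_{1..n} => (m1 != m2) && tle m1 m2)
}.

Definition tlt n (ord : term_ordering n) : rel 'X_{1..n} :=
  fun m1 m2 => (m1 != m2) && ord m1 m2.

Definition finite_below n (ord : term_ordering n) : Prop :=
  forall m, exists s : seq 'X_{1..n}, forall w, tlt ord w m -> w \in s.

Definition max_term (R : idomainType) n (ord : term_ordering n)
    (f : {mpoly R[n]}) : 'X_{1..n} :=
  if msupp f is m :: s then
    foldr (fun m1 m2 => if ord m1 m2 then m2 else m1) m s
  else 0%MM.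

Lemma max_termP (R : idomainType) n (ord : term_ordering n)
    (f : {mpoly R[n]}) : f != 0 ->
  max_term ord f \in msupp f /\
  forall m, m \in msupp f -> ord m (max_term ord f).
Proof.
have ordxx m : ord m m by have /orP[] := tle_total ord m m.
rewrite -msupp_eq0 /max_term; case: (msupp f) => //= m s _.
elim: s => [|a s [IHin IHle]] /=.
  by split=> [|k]; rewrite inE // => /eqP->.
have aF : ord a (foldr (fun m1 m2 => if ord m1 m2 then m2 else m1) m s) \/
          ord (foldr (fun m1 m2 => if ord m1 m2 then m2 else m1) m s) a.
  exact/orP/tle_total.
split=> [|k].
  case: ifP => _; rewrite !inE ?eqxx ?orbT //.
  by move: IHin; rewrite inE => /orP[->|->]; rewrite ?orbT.
rewrite !inE orbCA => /orP[/eqP->|kin]; first by case: ifP.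
have kle := IHle k kin.
case: ifP => // aFn; case: aF => [aF|Fa]; first by rewrite aF in aFn.
exact: tle_trans kle Fa.
Qed.

Definition lcoef (R : idomainType) n (ord : term_ordering n)
    (f : {mpoly R[n]}) : R := f@_(max_term ord f).

Definition max_monom (R : idomainType) n (ord : term_ordering n)
    (f : {mpoly R[n]}) : {mpoly R[n]} := lcoef ord f *: 'X_[max_term ord f].

(* The set F = {g_1, ..., g_u} is given by its indexing g.  An entry          *)
(* (a, k, rho) of a list stands for the summand a (g_k * rho).                *)
Definition restricted_sum (R : idomainType) n (D : ore_data R n) u
    (g : 'I_u -> {mpoly R[n]}) (s : seq (R * 'I_u * 'X_{1..n})) :
    {mpoly R[n]} :=
  \sum_(x <- s) x.1.1 *: ore_mul D (g x.1.2) 'X_[x.2].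

Definition in_IW (R : idomainType) n (D : ore_data R n) u
    (g : 'I_u -> {mpoly R[n]}) (f : {mpoly R[n]}) : Prop :=
  exists s, f = restricted_sum D g s.

(* T(0) is undefined, so 0 only has the empty representation. *)
Definition has_restricted_repr (R : idomainType) n (D : ore_data R n)
    (ord : term_ordering n) u (g : 'I_u -> {mpoly R[n]})
    (f : {mpoly R[n]}) : Prop :=
  exists2 s, f = restricted_sum D g s &
    forall x, x \in s ->
      [/\ f != 0, x.1.1 != 0
        & ord (max_term ord (g x.1.2) + x.2)%MM (max_term ord f)].

Definition restricted_normal_form (R : idomainType) n (D : ore_data R n)
    (ord : term_ordering n) u (g : 'I_u -> {mpoly R[n]})
    (f h : {mpoly R[n]}) : Prop :=
  has_restricted_repr D ord g (f - h) /\
  (h != 0 ->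
   ~ exists2 s : seq (R * 'I_u * 'X_{1..n}),
       max_monom ord h =
         \sum_(x <- s) (x.1.1 * lcoef ord (g x.1.2)) *:
                         'X_[max_term ord (g x.1.2) + x.2]
     & forall x, x \in s ->
         x.1.1 != 0 /\ (max_term ord (g x.1.2) + x.2)%MM = max_term ord h).

(* B_W(i, j), where qi = lcm(c_i, c_j) / c_i and qj = lcm(c_i, c_j) / c_j *)
Definition BW (R : idomainType) n (D : ore_data R n) (ord : term_ordering n) u
    (g : 'I_u -> {mpoly R[n]}) (i j : 'I_u) (qi qj : R) : {mpoly R[n]} :=
  let ti := max_term ord (g i) in
  let tj := max_term ord (g j) in
  qj *: ore_mul D (g j) 'X_[mlcm ti tj - tj] -
  qi *: ore_mul D (g i) 'X_[mlcm ti tj - ti].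

(* Main.v *)
(** In the commutative diamond product, written by juxtaposition, put
    [g_k = M(g_k) + p_k].  Up to a unit, coprimality turns [B_W(i, j)] into
    [M(g_i) g_j - M(g_j) g_i = p_j g_i - p_i g_j], which is a combination of the
    [g_i * rho] and [g_j * rho].  No leading term cancels:
    [T(p_j) tau_i = T(p_i) tau_j] with coprime [tau_i], [tau_j] would make
    [tau_j] divide [T(p_j)], although [T(p_j) < tau_j]. *)

Require Import Defs.
From HB Require Import structures.
From mathcomp Require Import all_boot all_order all_algebra.
From mathcomp.multinomials Require Import mpoly.
From mathcomp Require Import zify ring.

Set Implicit Arguments.
Unset Strict Implicit.
Unset Printing Implicit Defensive.

Import GRing.Theory.
Local Open Scope ring_scope.

(** * Term orderings: strict monotonicity and divisibility *)

Section TermOrdering.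
Variables (n : nat) (ord : term_ordering n).
Implicit Types (a b c d m : 'X_{1..n}).

Lemma tle_refl : reflexive ord.
Proof. by move=> m; have /orP[] := tle_total ord m m. Qed.

Lemma tltNge a b : tlt ord a b = ~~ ord b a.
Proof.
rewrite /tlt; case: (eqVneq a b) => [->|ab] /=; first by rewrite tle_refl.
have /orP[le|le] := tle_total ord a b; rewrite le; last first.
  by apply: contraNF ab => le'; apply/eqP/(@tle_anti n ord); rewrite le le'.
apply/esym; apply: contraNN ab => le'.
by apply/eqP/(@tle_anti n ord); rewrite le le'.
Qed.

Lemma tle_add a b c d : ord a b -> ord c d -> ord (a + c)%MM (b + d)%MM.
Proof.
move=> /(@tle_mul n ord _ _ c) ab /(@tle_mul n ord _ _ b) cd.
by apply: tle_trans ab _; rewrite ![(b + _)%MM]addmC.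
Qed.

(** Strictness survives by cancellation: equal sums would squeeze [a + c] and [b + c] together,
    hence give [a = b]. *)
Lemma tlt_tle_add a b c d :
  tlt ord a b -> ord c d -> tlt ord (a + c)%MM (b + d)%MM.
Proof.
case/andP=> ab le_ab le_cd; rewrite /tlt tle_add // andbT.
apply: contraNneq ab => e; apply/eqP/(@addIm n c)/(@tle_anti n ord).
rewrite tle_mul //= e.
by rewrite ![(b + _)%MM]addmC tle_mul.
Qed.

(* Otherwise the powers of [m] would form an infinite descending chain. *)
Lemma tle0m m : ord 0%MM m.
Proof.
rewrite -[ord _ _]negbK -tltNge; apply/negP=> m0.
have descent (x : 'X_{1..n}) : False.
  elim: (tlt_wf ord x) => {}x _ IH; apply: (IH (m + x)%MM).
  by have := tlt_tle_add m0 (tle_refl x); rewrite add0m.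
exact: descent m.
Qed.

Lemma tle_mnm_le a b : (a <= b)%MM -> ord a b.
Proof.
by move/submK <-; rewrite -{1}[a]add0m; apply: tle_mul; apply: tle0m.
Qed.

End TermOrdering.

(** Euclid's lemma for terms: the first premise makes [a] or [b] vanish at each index, so [a]
    contributes nothing where [b] is positive. *)
Lemma mlcm_coprime n (a b : 'X_{1..n}) k :
  mlcm a b = (a + b)%MM -> (b <= k + a)%MM -> (b <= k)%MM.
Proof.
move=> /mnmP ab /mnm_lepP bka; apply/mnm_lepP=> i.
by have := ab i; have := bka i; rewrite !mnmE; lia.
Qed.

(** * Maximal terms under the commutative product and under differences *)

Section LeadingTerm.
Variables (R : idomainType) (n : nat) (ord : term_ordering n).
Implicit Types (f g h : {mpoly R[n]}) (m : 'X_{1..n}).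

Lemma mcoeff_le_max_term f m : f@_m != 0 -> ord m (max_term ord f).
Proof.
move=> fm; apply: (max_termP ord _).2; last by rewrite mcoeff_msupp.
by apply: contraNneq fm => ->; rewrite mcoeff0.
Qed.

Lemma lcoef_neq0 f : f != 0 -> lcoef ord f != 0.
Proof. by case/(max_termP ord); rewrite mcoeff_msupp. Qed.

Definition tail f := f - max_monom ord f.

Lemma tail_max_monom f : f = tail f + max_monom ord f.
Proof. by rewrite subrK. Qed.

Lemma tail_lt f m : (tail f)@_m != 0 -> tlt ord m (max_term ord f).
Proof.
rewrite mcoeffB mcoeffZ mcoeffX /tlt [max_term _ _ == _]eq_sym.
case: (eqVneq m _) => [->|_]; first by rewrite mulr1 subrr eqxx.
by rewrite mulr0 subr0; apply: mcoeff_le_max_term.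
Qed.

Lemma mcoeffM_eq0 f g m :
  (forall a b, f@_a != 0 -> g@_b != 0 -> m <> (a + b)%MM) -> (f * g)@_m = 0.
Proof.
move=> mN; apply: memN_msupp_eq0; apply/negP=> /msuppM_le /allpairsP[[a b]] /=.
by rewrite !mcoeff_msupp => -[fa gb e]; apply: mN e.
Qed.

(** A term of [tail f] times a term of [g] lies strictly below the sum of the maximal terms, so only
    [max_monom ord f * g] contributes. *)
Lemma mcoeffM_max_term f g :
  (f * g)@_(max_term ord f + max_term ord g) = lcoef ord f * lcoef ord g.
Proof.
set m := (_ + _)%MM; have ltm a b : tlt ord (a + b)%MM m -> m <> (a + b)%MM.
  by move=> + e; rewrite -e /tlt eqxx.
rewrite {1}[f]tail_max_monom mulrDl mcoeffD mcoeffM_eq0 ?add0r; last first.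
  move=> a b /tail_lt fa /mcoeff_le_max_term gb; apply: ltm.
  exact: tlt_tle_add.
by rewrite -scalerAl mcoeffZ mulrC [X in X@_ _]mulrC mcoeffMX mulrC.
Qed.

Lemma max_termM f g : f != 0 -> g != 0 ->
  max_term ord (f * g) = (max_term ord f + max_term ord g)%MM.
Proof.
move=> f0 g0; have fg0 : f * g != 0 by rewrite mulf_neq0.
apply: (@tle_anti n ord); apply/andP; split; last first.
  by apply: mcoeff_le_max_term; rewrite mcoeffM_max_term mulf_neq0 ?lcoef_neq0.
have [/msuppM_le/allpairsP[[a b]] /= + _] := max_termP ord fg0.
rewrite !mcoeff_msupp => -[fa gb ->].
by apply: tle_add; apply: mcoeff_le_max_term.
Qed.

(** With distinct maximal terms the larger one survives in the difference. The premise is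
    conditional on [g != 0] because [max_term ord 0] is the default [0%MM], which can coincide with
    the maximal term of a nonzero constant [f]. *)
Lemma max_term_le_sub f g :
  f != 0 -> (g != 0 -> max_term ord f != max_term ord g) ->
  f - g != 0 /\ ord (max_term ord f) (max_term ord (f - g)).
Proof.
move=> f0 fg.
suff [m le_m fgm] : exists2 m, ord (max_term ord f) m & (f - g)@_m != 0.
  split; first by apply: contraNneq fgm => ->; rewrite mcoeff0.
  exact: tle_trans le_m (mcoeff_le_max_term fgm).
have [gf|] := eqVneq g@_(max_term ord f) 0.
  exists (max_term ord f); first exact: tle_refl.
  by rewrite mcoeffB gf subr0 lcoef_neq0.
move=> gf; have le_fg := mcoeff_le_max_term gf.
have g0 : g != 0 by apply: contraNneq gf => ->; rewrite mcoeff0.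
(* Now the maximal term of [f] occurs in [g]; if that of [g] also occurred in [f], the two would be
   equal. *)
exists (max_term ord g) => //; rewrite mcoeffB.
have [->|fg0] := eqVneq f@_(max_term ord g) 0.
  by rewrite sub0r oppr_eq0 lcoef_neq0.
case/eqP: (fg g0); apply: (@tle_anti n ord).
by rewrite le_fg mcoeff_le_max_term.
Qed.

Lemma max_termN f : max_term ord (- f) = max_term ord f.
Proof.
have [->|f0] := eqVneq f 0; first by rewrite oppr0.
apply: (@tle_anti n ord); apply/andP; split; apply: mcoeff_le_max_term.
  by rewrite -oppr_eq0 -mcoeffN lcoef_neq0 ?oppr_eq0.
by rewrite mcoeffN oppr_eq0 lcoef_neq0.
Qed.

Lemma mpoly_scale_eq0 (c : R) f : (c *: f == 0) = (c == 0) || (f == 0).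
Proof. by rewrite -mul_mpolyC mulf_eq0 mpolyC_eq0. Qed.

Lemma max_termZ c f : c != 0 -> max_term ord (c *: f) = max_term ord f.
Proof.
move=> c0; have [->|f0] := eqVneq f 0; first by rewrite scaler0.
apply: (@tle_anti n ord); apply/andP; split; apply: mcoeff_le_max_term.
  have : lcoef ord (c *: f) != 0 by rewrite lcoef_neq0 // mpoly_scale_eq0 negb_or c0.
  by rewrite /lcoef mcoeffZ mulf_eq0 negb_or => /andP[].
by rewrite mcoeffZ mulf_neq0 // lcoef_neq0.
Qed.

Lemma tailM_max_term_neq f g :
    mlcm (max_term ord f) (max_term ord g) =
      (max_term ord f + max_term ord g)%MM ->
    tail g * f != 0 -> tail f * g != 0 ->
  max_term ord (tail g * f) != max_term ord (tail f * g).
Proof.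
move=> fg; rewrite !mulf_eq0 !negb_or => /andP[tg0 f0] /andP[tf0 g0].
rewrite !max_termM //; apply/eqP=> e.
have /tail_lt := lcoef_neq0 tg0; rewrite tltNge => /negP; apply.
apply: tle_mnm_le; apply: mlcm_coprime fg _.
by rewrite e addmC lem_addr.
Qed.

End LeadingTerm.

(** * Restricted representations from diamond multiples *)

Section Representation.
Variables (R : idomainType) (n : nat) (D : ore_data R n).
Variables (ord : term_ordering n) (u : nat) (g : 'I_u -> {mpoly R[n]}).
Implicit Types (f p : {mpoly R[n]}).

(** Multiplying by a term on the right is the same for both products, so any diamond multiple of
    [g k] expands over the terms of the cofactor into restricted summands. *)
Definition diamond_terms (c : R) (k : 'I_u) p :=
  [seq (c * p@_m, k, m) | m <- msupp p].

Lemma restricted_sum_diamond_terms c k p :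
  restricted_sum D g (diamond_terms c k p) = c *: (p * g k).
Proof.
rewrite {2}[p]mpolyE mulr_suml scaler_sumr /restricted_sum big_map.
by apply: eq_bigr => m _ /=; rewrite ore_mulXr -scalerAl scalerA [g k * _]mulrC.
Qed.

(** Since [R] is a domain, no coefficient [c * p@_m] vanishes and maximal terms add, which gives the
    bound. *)
Lemma diamond_terms_le c k p x : c != 0 -> g k != 0 ->
  x \in diamond_terms c k p ->
  [/\ p * g k != 0, x.1.1 != 0
    & ord (max_term ord (g x.1.2) + x.2)%MM (max_term ord (p * g k))].
Proof.
move=> c0 gk0 /mapP[m]; rewrite mcoeff_msupp => pm -> /=.
have p0 : p != 0 by apply: contraNneq pm => ->; rewrite mcoeff0.
rewrite !mulf_neq0 // max_termM // addmC; split=> //.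
by apply: tle_mul; apply: mcoeff_le_max_term.
Qed.

Lemma coprime_restricted_repr (i j : 'I_u) e :
    g i != 0 -> g j != 0 -> e != 0 ->
    mlcm (max_term ord (g i)) (max_term ord (g j)) =
      (max_term ord (g i) + max_term ord (g j))%MM ->
  has_restricted_repr D ord g
    (e *: (max_monom ord (g i) * g j - max_monom ord (g j) * g i)).
Proof.
move=> gi0 gj0 e0 ij.
(* Replacing each maximal monomial by [g k] minus its tail makes the products [g i * g j] cancel. *)
pose A := tail ord (g j) * g i; pose B := tail ord (g i) * g j.
have -> : max_monom ord (g i) * g j - max_monom ord (g j) * g i = A - B.
  by rewrite /A /B /tail; ring.
have neqAB := tailM_max_term_neq ij.
exists (diamond_terms e i (tail ord (g j)) ++
        diamond_terms (- e) j (tail ord (g i))).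
  rewrite /restricted_sum big_cat -!/(restricted_sum _ _ _) /=.
  by rewrite !restricted_sum_diamond_terms scaleNr -scalerBr.
(* An entry of either list certifies that its own product, [A] or [B], is nonzero; the other product
   may be zero. *)
move=> x; rewrite mem_cat mpoly_scale_eq0 negb_or e0 max_termZ //= => /orP[].
  case/diamond_terms_le=> // A0 x0 le_x.
  have [] := @max_term_le_sub _ _ ord A B A0; first by move=> B0; apply: neqAB.
  by move=> AB0 le_A; split=> //; apply: tle_trans le_x le_A.
case/diamond_terms_le; rewrite ?oppr_eq0 // => B0 x0 le_x.
have [] := @max_term_le_sub _ _ ord B A B0.
  by move=> A0; rewrite eq_sym; apply: neqAB.
rewrite -opprB oppr_eq0 max_termN => AB0 le_B; split=> //.
exact: tle_trans le_x le_B.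
Qed.

End Representation.

(** * The coprimality criterion *)

Lemma diamond_max_monom (R : idomainType) n (ord : term_ordering n)
    (f g : {mpoly R[n]}) :
  diamond (max_monom ord f) (max_monom ord g) =
  (lcoef ord f * lcoef ord g) *: 'X_[max_term ord f + max_term ord g].
Proof. by rewrite /diamond -scalerAl -scalerAr scalerA mpolyXD. Qed.

Lemma scale_mpolyX_inj (R : idomainType) n (a b : R) (m k : 'X_{1..n}) :
  a != 0 -> a *: 'X_[m] = b *: 'X_[k] -> m = k /\ a = b.
Proof.
move=> a0 /(congr1 (mcoeff m)); rewrite !mcoeffZ !mcoeffX eqxx mulr1.
case: (eqVneq k m) => [->|_]; rewrite ?mulr1 ?mulr0 // => e.
by rewrite e eqxx in a0.
Qed.

Theorem lemma70 (R : idomainType) (pidR : principal_ideals R)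
    (V : choiceType) (p : {rmorphism free_ring V -> R}) (pP : presents p)
    (n : nat) (D : ore_data R n)
    (ord : term_ordering n) (ord_fin : finite_below ord)
    (u : nat) (g : 'I_u -> {mpoly R[n]}) (g_neq0 : forall k, g k != 0)
    (IW_ideal : ore_ideal D (in_IW D g))
    (Yg_repr : forall (k : 'I_u) (i : 'I_n),
       has_restricted_repr D ord g (ore_mul D 'X_i (g k)))
    (gv_repr : forall (k : 'I_u) (v : V) (w : 'X_{1..n}),
       tlt ord w (max_term ord (g k)) ->
       has_restricted_repr D ord g
         (ore_mul D (g k) (ore_alpha_term D w (p (free_gen v)))%:MP))
    (i j : 'I_u) (lt_ij : (i < j)%N)
    (l qi qj : R)
    (l_lcm : is_lcm (lcoef ord (g i)) (lcoef ord (g j)) l)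
    (qiE : l = qi * lcoef ord (g i)) (qjE : l = qj * lcoef ord (g j)) :
  let ci := lcoef ord (g i) in
  let cj := lcoef ord (g j) in
  let ti := max_term ord (g i) in
  let tj := max_term ord (g j) in
  let Mij := l *: 'X_[mlcm ti tj] in
  let coprimeM := exists2 e : R, e \is a GRing.unit &
    diamond (max_monom ord (g i)) (max_monom ord (g j)) = e *: Mij in
  (coprimeM <->
     mlcm ti tj = (ti + tj)%MM /\
     exists2 e : R, e \is a GRing.unit & l = e * (ci * cj)) /\
  (coprimeM -> restricted_normal_form D ord g (BW D ord g i j qi qj) 0).
Proof.
move=> ci cj ti tj Mij coprimeM.
have ci0 : ci != 0 by apply: lcoef_neq0.
have cj0 : cj != 0 by apply: lcoef_neq0.
have coprimeP : coprimeM <-> mlcm ti tj = (ti + tj)%MM /\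
    exists2 e : R, e \is a GRing.unit & l = e * (ci * cj).
  rewrite /coprimeM /Mij diamond_max_monom; split=> [[e eU]|[-> [e eU ->]]].
    rewrite scalerA => /scale_mpolyX_inj[]; first by rewrite mulf_neq0.
    (* The unit multiplies [l] in one condition and [ci * cj] in the other, hence the inverse in
       both directions. *)
    move=> -> el; split=> //; exists e^-1; first by rewrite unitrV.
    by rewrite -/ci -/cj in el; rewrite el mulKr.
  exists e^-1; first by rewrite unitrV.
  by rewrite scalerA mulKr.
split=> // /coprimeP[lcmE [e eU lE]].
have e0 : e != 0 by apply: contraTneq eU => ->; rewrite unitr0.
(* Cancelling a leading coefficient in [l = e * (ci * cj)] turns each cofactor into the opposite
   leading coefficient times the unit. *)
have qi_e : qi = e * cj by apply: (mulIf ci0); rewrite -qiE lE; ring.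
have qj_e : qj = e * ci by apply: (mulIf cj0); rewrite -qjE lE; ring.
split; last by rewrite eqxx.
suff -> : BW D ord g i j qi qj - 0 =
    e *: (max_monom ord (g i) * g j - max_monom ord (g j) * g i).
  exact: coprime_restricted_repr.
(* The complementary terms are likewise [ti] and [tj], so the multipliers in [BW] assemble into [e]
   times maximal monomials. *)
rewrite subr0 /BW -/ti -/tj lcmE addmK addmC addmK !ore_mulXr qi_e qj_e.
rewrite scalerBr -!scalerAl !scalerA.
by rewrite ![_ * 'X_[_]]mulrC.
Qed.
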